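(* There is a universal constant $C>0$ such that the following holds in the joint pricing-assignment model described in the context. Fix a set $V$ of $m=|V|>1$ nodes, minimum and maximum allowed prices $(p_\tau^{\min},p_\tau^{\max})_{\tau\in\mathcal T}$, any (time-invariant) demand arrival rates and neighborhoods $(\boldsymbol\phi,\mathcal P,\mathcal D)$ with $\alpha(\boldsymbol\phi,\mathcal P,\mathcal D)>0$, and willingness-to-pay distributions $(F_\tau)_{\tau\in\mathcal T}$ satisfying the regularity conditions in the context. Then there exist $K_1<\infty$, $M_1=Cm$ and $M_2=Cm^2$ such that, for the congestion function $f(\bar q)=-\sqrt m\,\bar q^{-1/2}$ (used at every node), the MBP policy for joint pricing-assignment satisfies, for any horizon $T$ and any $K\ge K_1$, $$L_T^{\mathrm{MBP}}\le M_1\frac KT+M_2\frac1K\qquad\text{and}\qquad L^{\mathrm{MBP}}\le M_2\frac1K .$$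
   Context: **Model (joint pricing-assignment).** $V$ is a finite set of nodes, $m=|V|>1$; $K$ identical supply units circulate. $\mathcal T$ is a finite set of demand types; each $\tau$ has nonempty pick-up and drop-off neighborhoods $\mathcal P(\tau),\mathcal D(\tau)\subseteq V$. Time is slotted, $t=1,2,\dots$; the state at the start of period $t$ is $\mathbf q[t]\in\Omega_K=\{\mathbf q\in\mathbb Z_{\ge0}^V:\sum_jq_j=K\}$ (buffers are infinite). In each period exactly one demand unit arrives, whose type $\tau[t]$ is i.i.d. with distribution $\boldsymbol\phi=(\phi_\tau)_{\tau\in\mathcal T}$. After observing $\tau[t]=\tau$ the platform chooses a price $p_\tau[t]\in[p_\tau^{\min},p_\tau^{\max}]$ and a decision $x_{j\tau k}[t]\in\{0,1\}$ ($j\in\mathcal P(\tau),k\in\mathcal D(\tau)$) with $\sum_{j,k}x_{j\tau k}[t]\le1$ and $x_{j\tau k}[t]=0$ if $q_j[t]=0$. The demand unit declines with probability $F_\tau(p_\tau[t])$ and otherwise accepts. If it accepts and $x_{j\tau k}[t]=1$, a supply unit moves from $j$ to $k$ (so $\mathbf q[t+1]=\mathbf q[t]-\mathbf e_j+\mathbf e_k$) and the payoff is $v[t]=p_\tau[t]-c_{j\tau k}$, where $c_{j\tau k}\in\mathbb R$ is a given cost. If it declines, or all $x=0$, the state does not change and $v[t]=0$. Feasible policies map the history to such (possibly randomized) decisions. Normalization: $\max_\tau p_\tau^{\max}+\max_{j,\tau,k}|c_{j\tau k}|=1$. **Regularity conditions.** (1) $F_\tau(p_\tau^{\min})=0$,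 $F_\tau(p_\tau^{\max})=1$. (2) Each type's willingness-to-pay is non-atomic with support $[p_\tau^{\min},p_\tau^{\max}]$ and positive density everywhere on the support, so $F_\tau$ is differentiable and strictly increasing on $(p_\tau^{\min},p_\tau^{\max})$. (3) Let $p_\tau(\mu)$, $\mu\in[0,1]$, be the price at which a fraction $\mu$ of type-$\tau$ demand accepts, i.e. $F_\tau(p_\tau(\mu))=1-\mu$; the revenue function $r_\tau(\mu)=\mu\,p_\tau(\mu)$ is concave and twice continuously differentiable. **Connectedness.** $\alpha(\boldsymbol\phi,\mathcal P,\mathcal D)=\min_{\emptyset\ne S\subsetneq V}\sum_{\tau:\ \mathcal P(\tau)\cap S\ne\emptyset,\ \mathcal D(\tau)\cap(V\setminus S)\ne\emptyset}\phi_\tau$. **Performance.** $W_T^\pi=\min_{\mathbf q\in\Omega_K}\frac1T\sum_{t=1}^T\mathbb E[v^\pi[t]\mid\mathbf q[1]=\mathbf q]$, $W_T^*=\sup_\pi\max_{\mathbf q\in\Omega_K}\frac1T\sum_{t=1}^T\mathbb E[v^\pi[t]\mid\mathbf q[1]=\mathbf q]$ (sup over feasible policies, which may depend on $\boldsymbol\phi$), $L_T^\pi=W_T^*-W_T^\pi$; $W^\pi=\liminf_TW_T^\pi$, $W^*=\limsup_TW_T^*$, $L^\pi=W^*-W^\pi$. **MBP policy for joint pricing-assignment.** Normalized queue lengths: $\bar q_j=(q_j+\sqrt K)/\tilde K$, $\tilde K=K+m\sqrt K$. In period $t$ with $\tau[t]=\tau$: let $(j^*,k^* )$ maximize $-c_{j\tau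 k}+f(\bar q_j[t])-f(\bar q_k[t])$ over $j\in\mathcal P(\tau),k\in\mathcal D(\tau)$. If $q_{j^*}[t]>0$: let $\mu_\tau[t]\in\arg\max_{\mu\in[0,1]}\{r_\tau(\mu)+\mu(-c_{j^*\tau k^*}+f(\bar q_{j^*}[t])-f(\bar q_{k^*}[t]))\}$, post the price $p_\tau[t]=p_\tau(\mu_\tau[t])$, and set $x_{j^*\tau k^*}[t]=1$ (all other $x=0$). If $q_{j^*}[t]=0$, drop the demand (all $x=0$).
   Formalization: Prices are assumed nonnegative (p_τ^min ≥ 0), so that the normalization bounds all payoffs by 1; with arbitrarily negative prices on demand linking two clusters of nodes, no universal constant C exists. *)

(* Defs.v *)
From mathcomp Require Import all_boot all_order all_algebra.
From mathcomp Require Import all_classical all_reals all_analysis.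

Set Implicit Arguments.
Unset Strict Implicit.
Unset Printing Implicit Defensive.

Import Order.TTheory GRing.Theory Num.Theory.
Import numFieldNormedType.Exports.

Local Open Scope classical_set_scope.
Local Open Scope ring_scope.

Record market (R : realType) (V Tau : finType) := Market {
  phi : Tau -> R;
  pickup : Tau -> {set V};
  dropoff : Tau -> {set V};
  pmin : Tau -> R;
  pmax : Tau -> R;
  cost : V -> Tau -> V -> R;
  wtp : Tau -> probability (measurableTypeR R) R
    (* law of the willingness-to-pay of a type *)
}.

Section Market.
Context {R : realType} {V Tau : finType} (M : market R V Tau).

(* The neutral elements 0 are harmless: the maxima range over nonnegative
   reals. Prices are nonnegative, so that the normalization bounds every
   payoff by 1 in absolute value. *)
Record market_ok : Prop := MarketOk {
  phi_ge0 : forall tau, 0 <= phi M tau;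
  phi_sum1 : \sum_tau phi M tau = 1;
  pickup_neq0 : forall tau, exists j, j \in pickup M tau;
  dropoff_neq0 : forall tau, exists k, k \in dropoff M tau;
  pmin_ge0 : forall tau, 0 <= pmin M tau;
  normalized :
    \big[Num.max/0]_tau pmax M tau +
    \big[Num.max/0]_tau \big[Num.max/0]_(j in pickup M tau)
      \big[Num.max/0]_(k in dropoff M tau) `|cost M j tau k| = 1
}.

(* Every sum below is at most 1 for a probability vector phi, so the neutral
   element 1 does not affect the minimum (the index set is nonempty as soon as
   #|V| > 1). *)
Definition connectedness : R :=
  \big[Num.min/1]_(S : {set V} | (0 < #|S| < #|V|)%N)
    \sum_(tau | [exists j in pickup M tau, j \in S] &&
                [exists k in dropoff M tau, k \notin S]) phi M tau.

(* F_tau; whether the inequality is strict is immaterial for non-atomic laws *)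
Definition wtp_cdf (tau : Tau) (p : R) : R :=
  fine (wtp M tau [set x : measurableTypeR R | x <= p]).

(* The price p_tau(mu); it is unique under the regularity conditions *)
Definition price_of (tau : Tau) (mu : R) : R :=
  xget (pmin M tau)
    [set p | pmin M tau <= p <= pmax M tau /\ wtp_cdf tau p = 1 - mu].

Definition revenue (tau : Tau) (mu : R) : R := mu * price_of tau mu.

End Market.

Definition law_support {R : realType} (P : probability (measurableTypeR R) R) :
    set R :=
  [set x | forall U : set R, open U -> U x -> (0 < P U)%E].

(* df is the derivative of f relative to [0, 1] (one-sided at 0 and 1) *)
Definition derivative_on_01 {R : realType} (f df : R -> R) : Prop :=
  forall x, `[0, 1]%classic x ->
    (f y - f x) / (y - x) @[y --> within `[0, 1]%classic x^'] --> df x.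

Definition C2_on_01 {R : realType} (f : R -> R) : Prop :=
  exists df d2f : R -> R,
    [/\ derivative_on_01 f df, derivative_on_01 df d2f &
        {within `[0, 1]%classic, continuous d2f}].

Section Regularity.
Context {R : realType} {V Tau : finType} (M : market R V Tau).

Record regular_type (tau : Tau) : Prop := RegularType {
  cdf_pmin : wtp_cdf M tau (pmin M tau) = 0;
  cdf_pmax : wtp_cdf M tau (pmax M tau) = 1;
  wtp_nonatomic :
    forall x : measurableTypeR R, wtp M tau [set x] = 0%E;
  wtp_support : law_support (wtp M tau) = `[pmin M tau, pmax M tau]%classic;
  wtp_density : exists g : measurableTypeR R -> R,
    [/\ measurable_fun setT g,
        forall x, 0 <= g x,
        forall x, pmin M tau <= x <= pmax M tau -> 0 < g x &
        forall A : set (measurableTypeR R), measurable A ->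
          wtp M tau A = (\int[lebesgue_measure]_(x in A) (g x)%:E)%E];
  cdf_derivable : forall x, pmin M tau < x < pmax M tau ->
    derivable (wtp_cdf M tau) x 1;
  revenue_concave :
    convex_function (E := R^o) `[0, 1]%classic (fun mu => - revenue M tau mu);
  revenue_C2 : C2_on_01 (revenue M tau)
}.

Definition regular : Prop := forall tau, regular_type tau.

End Regularity.

Section Dynamics.
Context {R : realType} {V Tau : finType}.

Definition state := {ffun V -> nat}.

Definition Omega_ (K : nat) : set state := [set q | (\sum_j q j = K)%N].

(* [assign = Some (j, k)] encodes x_{j tau k} = 1 and all other x = 0;
   [assign = None] encodes x = 0. *)
Record action := Action { price : R; assign : option (V * V) }.

Record period := Period {
  before : state;
  dtype : Tau;
  taken : action;
  accepted : bool
}.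

Definition move (q : state) (j k : V) : state :=
  [ffun i => (q i - (i == j) + (i == k))%N].

Definition after (e : period) : state :=
  if accepted e then
    if assign (taken e) is Some (j, k) then move (before e) j k else before e
  else before e.

(* A randomized policy draws a private seed, independent of the demand, and
   then reacts to the past periods (most recent first), the current state and
   the observed type. *)
Record policy := Policy {
  seed_display : measure_display;
  seed : measurableType seed_display;
  seed_law : probability seed R;
  act : seed -> seq period -> state -> Tau -> action
}.

Definition current (q1 : state) (h : seq period) : state :=
  if h is e :: _ then after e else q1.

(* Given the seed and q[1], the history is determined by the successive demand
   types and accept/decline responses, listed most recent first. *)
Fixpoint history (pi : policy) (w : seed pi) (q1 : state)
    (obs : seq (Tau * bool)) : seq period :=
  if obs is (tau, a) :: obs' then
    let h := history w q1 obs' in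
    let q := current q1 h in
    Period q tau (act w h q tau) a :: h
  else [::].

Definition act_after (pi : policy) (w : seed pi) (q1 : state)
    (obs : seq (Tau * bool)) (tau : Tau) : action :=
  let h := history w q1 obs in act w h (current q1 h) tau.

Variable M : market R V Tau.

Definition payoff (e : period) : R :=
  if accepted e then
    if assign (taken e) is Some (j, k)
    then price (taken e) - cost M j (dtype e) k else 0
  else 0.

Record feasible (pi : policy) : Prop := Feasible {
  price_feasible : forall (w : seed pi) h q tau,
    pmin M tau <= price (act w h q tau) <= pmax M tau;
  assign_feasible : forall (w : seed pi) h q tau j k,
    assign (act w h q tau) = Some (j, k) ->
    [/\ j \in pickup M tau, k \in dropoff M tau & (0 < q j)%N];
  price_measurable : forall q1 obs tau,
    measurable_fun setT (fun w : seed pi => price (act_after w q1 obs tau));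
  assign_measurable : forall q1 obs tau x,
    measurable [set w : seed pi | assign (act_after w q1 obs tau) = x]
}.

(* Conditional probability, given the seed, of a sequence of types and
   responses *)
Fixpoint obs_prob (pi : policy) (w : seed pi) (q1 : state)
    (obs : seq (Tau * bool)) : R :=
  if obs is (tau, a) :: obs' then
    let declines := wtp_cdf M tau (price (act_after w q1 obs' tau)) in
    obs_prob w q1 obs' * phi M tau * (if a then 1 - declines else declines)
  else 1.

Definition last_payoff (h : seq period) : R :=
  if h is e :: _ then payoff e else 0.

(* E[v[t] | q[1] = q1], for t >= 1 *)
Definition mean_payoff (pi : policy) (q1 : state) (t : nat) : R :=
  Rintegral (seed_law pi) setT (fun w =>
    \sum_(obs : t.-tuple (Tau * bool))
      obs_prob w q1 obs * last_payoff (history w q1 obs)).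

Definition average_payoff (pi : policy) (q1 : state) (T : nat) : R :=
  T%:R^-1 * \sum_(1 <= t < T.+1) mean_payoff pi q1 t.

(* Omega_K is finite and nonempty, so the inf and the inner sup below are
   attained. *)
Definition worst_payoff (K T : nat) (pi : policy) : R :=
  inf [set average_payoff pi q T | q in Omega_ K].

Definition optimal_payoff (K T : nat) : R :=
  sup [set W : R | exists2 pi : policy, feasible pi &
         W = sup [set average_payoff pi q T | q in Omega_ K]].

Definition loss (K T : nat) (pi : policy) : R :=
  optimal_payoff K T - worst_payoff K T pi.

Definition longrun_loss (K : nat) (pi : policy) : R :=
  limn_sup (fun T => optimal_payoff K T : R^o) -
  limn_inf (fun T => worst_payoff K T pi : R^o).

Definition qbar (K : nat) (q : state) (j : V) : R :=
  ((q j)%:R + Num.sqrt K%:R) / (K%:R + #|V|%:R * Num.sqrt K%:R).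

Definition congestion (x : R) : R := - Num.sqrt #|V|%:R * x `^ (- 2^-1).

(* When the demand is dropped the posted price is irrelevant, hence
   unspecified. Both argmax are arbitrary selections, possibly depending on the
   history and on the seed. *)
Definition is_MBP (f : R -> R) (K : nat) (pi : policy) : Prop :=
  forall (w : seed pi) h q tau, Omega_ K q ->
  let score j k := - cost M j tau k + f (qbar K q j) - f (qbar K q k) in
  let a := act w h q tau in
  exists j k,
    [/\ j \in pickup M tau, k \in dropoff M tau,
        forall j' k', j' \in pickup M tau -> k' \in dropoff M tau ->
          score j' k' <= score j k &
        if (0 < q j)%N then
          assign a = Some (j, k) /\
          exists mu, [/\ 0 <= mu <= 1,
            forall nu, 0 <= nu <= 1 ->
              revenue M tau nu + nu * score j k <=
              revenue M tau mu + mu * score j k &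
            price a = price_of M tau mu]
        else assign a = None].

End Dynamics.

Arguments policy : clear implicits.
Arguments congestion {R} V x.

(* Main.v *)
Require Import Defs.
From mathcomp Require Import all_boot all_order all_algebra.
From mathcomp Require Import all_classical all_reals all_analysis.
From mathcomp Require Import measurable_realfun ring lra.

(** Lagrangian duality with a convex potential. A price vector y on the nodes
    charges y_k - y_j for a move from j to k; [dual M y] is the best expected
    charged payoff of a single period. Telescoping sum_j y_j q_j along any
    policy bounds the optimum by [dual M y] + (spread of y) K / T. MBP attains
    [dual M y] at y = f(qbar), up to the drift of the potential
    - 2 sqrt m K~ sum_j sqrt qbar_j, whose gradient is y, a second-order term of
    size sqrt m w^3 / K~ with w = max_j qbar_j^(-1/2), and the demand it drops.
    Closing the large gaps between the values of y lowers the dual by at least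
    alpha / 2 times the spread of y in excess of 2 m. So when w > 4 sqrt m this
    slack pays for the second-order term and for the drops, once K is large;
    when w <= 4 sqrt m nothing is dropped and the second-order term is
    O(m^2 / K). *)

Set Implicit Arguments.
Unset Strict Implicit.
Unset Printing Implicit Defensive.

Import Order.TTheory GRing.Theory Num.Theory.
Import numFieldNormedType.Exports.

Local Open Scope classical_set_scope.
Local Open Scope ring_scope.

(** * Distribution functions and the prices realising a given acceptance rate *)

Section WillingnessToPay.
Context {R : realType} {V Tau : finType} (M : market R V Tau).

Lemma measurable_le_ray (p : R) :
  measurable [set x : measurableTypeR R | x <= p].
Proof. by rewrite -set_itvNyc; exact: measurable_itv. Qed.

Lemma wtp_cdf_ge0 tau p : 0 <= wtp_cdf M tau p.
Proof. by rewrite fine_ge0. Qed.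

Lemma wtp_cdf_le1 tau p : wtp_cdf M tau p <= 1.
Proof.
rewrite -lee_fin /wtp_cdf fineK; last exact: fin_num_measure (measurable_le_ray p).
exact: probability_le1 (measurable_le_ray p).
Qed.

Lemma wtp_cdf_homo tau : {homo wtp_cdf M tau : p q / p <= q}.
Proof.
move=> p q pq; apply: fine_le.
- exact: fin_num_measure (measurable_le_ray p).
- exact: fin_num_measure (measurable_le_ray q).
- apply: le_measure; rewrite ?inE; [exact: measurable_le_ray.. |].
  by move=> x /= /le_trans; apply.
Qed.

Hypothesis Mreg : regular M.

Lemma pmin_le_pmax tau : pmin M tau <= pmax M tau.
Proof.
rewrite leNgt; apply/negP => /ltW /(wtp_cdf_homo tau).
by rewrite (cdf_pmin (Mreg tau)) (cdf_pmax (Mreg tau)) ler10.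
Qed.

(** The midpoint of [p] and [q] lies in the support, so its open neighborhood []p, q[] carries
    positive mass. *)
Lemma wtp_cdf_strict tau (p q : R) : pmin M tau <= p -> q <= pmax M tau ->
  p < q -> wtp_cdf M tau p < wtp_cdf M tau q.
Proof.
move=> minp qmax pq.
have [pm mq] : p < (p + q) / 2 /\ (p + q) / 2 < q by split; lra.
have : law_support (wtp M tau) ((p + q) / 2).
  by rewrite (wtp_support (Mreg tau)) /= in_itv /=; apply/andP; split; lra.
move=> /(_ `]p, q[%classic (itv_open _ _)).
rewrite /= in_itv /= pm mq => /(_ isT) Ppq.
have mpq : measurable (`]p, q[%classic : set (measurableTypeR R)).
  exact: measurable_itv.
rewrite -lte_fin /wtp_cdf !fineK; try exact: fin_num_measure (measurable_le_ray _).
rewrite (@lt_le_trans _ _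
  (wtp M tau ([set x : measurableTypeR R | x <= p] `|` `]p, q[%classic)))//.
  rewrite measureU //; [|exact: measurable_le_ray|].
    rewrite lteDl//; exact: fin_num_measure (measurable_le_ray _).
  apply/seteqP; split=> // x /= []; rewrite in_itv /= => xp /andP[px _].
  by move: (le_lt_trans xp px); rewrite ltxx.
apply: le_measure; rewrite ?inE;
  [by apply: measurableU => //; exact: measurable_le_ray|exact: measurable_le_ray|].
move=> x /= []; first by move=> /le_trans -> //; exact: ltW.
by rewrite in_itv /= => /andP[_ /ltW].
Qed.

Lemma wtp_cdf_inj tau (p q : R) : pmin M tau <= p <= pmax M tau ->
  pmin M tau <= q <= pmax M tau -> wtp_cdf M tau p = wtp_cdf M tau q -> p = q.
Proof.
move=> /andP[p1 p2] /andP[q1 q2] e.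
case: (ltgtP p q) => // lt.
- by have := wtp_cdf_strict p1 q2 lt; rewrite e ltxx.
- by have := wtp_cdf_strict q1 p2 lt; rewrite e ltxx.
Qed.

(** Intermediate value theorem: between [pmin] and [pmax] the distribution function is an integral
    of the density, hence continuous, and it runs from 0 to 1. *)
Lemma wtp_cdf_surj tau v : 0 <= v <= 1 ->
  exists2 p, pmin M tau <= p <= pmax M tau & wtp_cdf M tau p = v.
Proof.
move=> v01.
set a := pmin M tau; set b := pmax M tau.
have ab : a <= b := pmin_le_pmax tau.
have [g [mg g0 _ gE]] := wtp_density (Mreg tau).
have intg : (@lebesgue_measure R).-integrable `[a, b] (EFin \o g).
  apply/integrableP; split.
    by apply/measurable_EFinP; exact: measurable_funTS.
  under eq_integral do rewrite /= ger0_norm ?g0//.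
  have := gE `[a, b]%classic (measurable_itv _) => <-.
  by rewrite ltey_eq fin_num_measure//; exact: measurable_itv.
have FE x : x \in `[a, b] ->
    wtp_cdf M tau x = parameterized_integral (@lebesgue_measure R) a x g.
  rewrite in_itv /= => /andP[ax _].
  rewrite /parameterized_integral /Rintegral.
  have := gE `[a, x]%classic (measurable_itv _) => <-.
  rewrite /wtp_cdf; congr fine.
  (* The ray is cut at [a]; nothing lies below [a], because the distribution function vanishes at
     [pmin]. *)
  have -> : [set x0 : measurableTypeR R | x0 <= x] =
      `]-oo, a[%classic `|` `[a, x]%classic.
    apply/seteqP; split=> y /=; rewrite !in_itv /=.
      by case: (ltP y a); [left|right].
    by case=> [/ltW /le_trans|/andP[]//]; apply.
  rewrite measureU; [| exact: measurable_itv| exact: measurable_itv|].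
    rewrite [X in (X + _)%E](_ : _ = 0%E) ?add0e//.
    apply/eqP; rewrite eq_le measure_ge0 andbT.
    apply: (@le_trans _ _ (wtp M tau [set x : measurableTypeR R | x <= a])).
      apply: le_measure; rewrite ?inE; [exact: measurable_itv|exact: measurable_le_ray|].
      by move=> y /=; rewrite in_itv /= => /ltW.
    rewrite -(fineK (fin_num_measure _ _ (measurable_le_ray a))).
    by have := cdf_pmin (Mreg tau); rewrite /wtp_cdf => ->.
  apply/seteqP; split=> // y /= []; rewrite !in_itv /= => ya /andP[ay _].
  by move: (lt_le_trans ya ay); rewrite ltxx.
have [|p pab pv] := IVT (v := v) ab (parameterized_integral_continuous ab intg).
  rewrite -!FE ?in_itv /= ?lexx ?ab//.
  rewrite (cdf_pmin (Mreg tau)) (cdf_pmax (Mreg tau)).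
  by rewrite (min_idPl _) ?(max_idPr _) ?ler01.
by exists p; [move: pab; rewrite in_itv|rewrite FE].
Qed.

Lemma price_ofP tau mu : 0 <= mu <= 1 ->
  pmin M tau <= price_of M tau mu <= pmax M tau /\
  wtp_cdf M tau (price_of M tau mu) = 1 - mu.
Proof.
move=> mu01; rewrite /price_of; case: xgetP => [p _ //|nop].
have [|p pab pv] := @wtp_cdf_surj tau (1 - mu); first by lra.
by case: (nop p).
Qed.

(** Choosing an admissible price amounts to choosing an acceptance rate, so the maximum of MBP over
    rates covers all admissible prices. *)
Lemma price_of_accept tau p : pmin M tau <= p <= pmax M tau ->
  price_of M tau (1 - wtp_cdf M tau p) = p.
Proof.
move=> pab; have [|h1 h2] := @price_ofP tau (1 - wtp_cdf M tau p).
  by have := wtp_cdf_ge0 tau p; have := wtp_cdf_le1 tau p; lra.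
by apply: (@wtp_cdf_inj tau) => //; rewrite h2; lra.
Qed.

End WillingnessToPay.

(** * The dual function of a price vector on the nodes *)

Section Dual.
Context {R : realType} {V Tau : finType} (M : market R V Tau).

Definition gain (y : V -> R) tau j k p : R :=
  (1 - wtp_cdf M tau p) * (p - cost M j tau k + y j - y k).

Definition gains (y : V -> R) tau : set R :=
  [set z | exists j k p, [/\ j \in pickup M tau, k \in dropoff M tau,
     pmin M tau <= p <= pmax M tau & z = gain y tau j k p]].

Definition dual_type y tau : R := sup (gains y tau).

Definition dual y : R := \sum_tau phi M tau * dual_type y tau.

Hypothesis Mok : market_ok M.

Lemma pmax_cost_le1 tau j k : j \in pickup M tau -> k \in dropoff M tau ->
  pmax M tau + `|cost M j tau k| <= 1.
Proof.
move=> jP kD; rewrite -(normalized Mok) lerD//.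
  exact: le_bigmax.
apply: le_trans (le_bigmax _ _ tau).
apply: le_trans (le_bigmax_cond _ _ jP).
exact: (le_bigmax_cond _ (fun k => `|cost M j tau k|) kD).
Qed.

Lemma price_cost tau j k p : j \in pickup M tau -> k \in dropoff M tau ->
  pmin M tau <= p <= pmax M tau ->
  [/\ 0 <= p <= 1, -1 <= cost M j tau k <= 1, p - cost M j tau k <= 1 &
      -1 <= p - cost M j tau k].
Proof.
move=> jP kD pp; have := pmax_cost_le1 jP kD; have := pmin_ge0 Mok tau.
have := ler_norm (cost M j tau k); have := ler_norm (- cost M j tau k).
rewrite normrN; move: pp => /andP[p1 p2] ? ? ? ?.
by split; try (apply/andP; split); lra.
Qed.

Hypothesis Mreg : regular M.

Lemma gains_neq0 y tau : gains y tau !=set0.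
Proof.
have [j jP] := pickup_neq0 Mok tau; have [k kD] := dropoff_neq0 Mok tau.
exists (gain y tau j k (pmin M tau)), j, k, (pmin M tau); split=> //.
by rewrite lexx pmin_le_pmax.
Qed.

(** A crude bound, needed because [sup] is meaningful only for sets bounded above. *)
Lemma gains_has_ubound y tau : has_ubound (gains y tau).
Proof.
exists (1 + \sum_i `|y i| + \sum_i `|y i|) => z [j [k [p [jP kD pp ->]]]].
have [_ _ h _] := price_cost jP kD pp.
have F0 := wtp_cdf_ge0 M tau p; have F1 := wtp_cdf_le1 M tau p.
have Y i : `|y i| <= \sum_i `|y i|.
  by rewrite (bigD1 i)//= lerDl sumr_ge0.
have Yj := le_trans (ler_norm _) (Y j).
have Yk : - y k <= \sum_i `|y i|.
  by apply: le_trans (ler_norm _) _; rewrite normrN.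
rewrite /gain; set s := \sum_i _ in Yj Yk *.
have s0 : 0 <= s by exact: sumr_ge0.
apply: (@le_trans _ _ ((1 - wtp_cdf M tau p) * (1 + s + s))).
  by apply: ler_wpM2l; lra.
by rewrite ler_piMl; lra.
Qed.

Lemma gain_le_dual_type y tau j k p : j \in pickup M tau ->
  k \in dropoff M tau -> pmin M tau <= p <= pmax M tau ->
  gain y tau j k p <= dual_type y tau.
Proof.
move=> jP kD pp; apply: ub_le_sup; first exact: gains_has_ubound.
by exists j, k, p.
Qed.

Lemma dual_type_le y tau B : (forall j k p, j \in pickup M tau ->
    k \in dropoff M tau -> pmin M tau <= p <= pmax M tau ->
    gain y tau j k p <= B) ->
  dual_type y tau <= B.
Proof.
move=> H; apply: ge_sup; first exact: gains_neq0.
by move=> z [j [k [p [jP kD pp ->]]]]; exact: H.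
Qed.

(** Posting [pmax] is always declined and gains 0. *)
Lemma dual_type_ge0 y tau : 0 <= dual_type y tau.
Proof.
have [j jP] := pickup_neq0 Mok tau; have [k kD] := dropoff_neq0 Mok tau.
apply: le_trans (gain_le_dual_type y jP kD (_ : _ <= pmax M tau <= _)).
  by rewrite /gain (cdf_pmax (Mreg tau)) subrr mul0r.
by rewrite lexx pmin_le_pmax.
Qed.

Definition crossing (S : {set V}) tau : bool :=
  [exists j in pickup M tau, j \in S] && [exists k in dropoff M tau, k \notin S].

Definition lower (y : V -> R) (S : {set V}) (d : R) : V -> R :=
  fun i => if i \in S then y i - d else y i.

(** * Decrease of the dual when the nodes above a gap are lowered *)

Section LowerUpperSet.
Variables (y : V -> R) (S : {set V}) (d : R).
Hypotheses (d_ge0 : 0 <= d)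
  (gap : forall i l, i \in S -> l \notin S -> 2 <= lower y S d i - lower y S d l).

Let z := lower y S d.

(* Exchanging an endpoint of a pair for one on the other side of the gap changes
   the costs by at most 2, so some crossing pair is optimal; its score is at least
   1, hence it is accepted with probability at least 1/2 or priced at pmin. *)
Lemma dual_type_lower_crossing tau : crossing S tau ->
  dual_type z tau + d / 2 <= dual_type y tau.
Proof.
move=> /andP[/exists_inP[j0 j0P j0S] /exists_inP[k0 k0D k0S]].
rewrite -lerBrDr; apply: dual_type_le => j k p jP kD pp; rewrite lerBrDr.
have [j' [k' [j'P k'D j'S k'S zz]]] : exists j' k', [/\ j' \in pickup M tau,
    k' \in dropoff M tau, j' \in S, k' \notin S &
    - cost M j tau k + z j - z k <= - cost M j' tau k' + z j' - z k'].
  have [p0 c0 _ _] := price_cost j0P k0D pp.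
  have [_ c1 _ _] := price_cost jP kD pp.
  have [_ c2 _ _] := price_cost j0P kD pp.
  have [_ c3 _ _] := price_cost jP k0D pp.
  case: (boolP (j \in S)) => jS; case: (boolP (k \in S)) => kS.
  - exists j, k0; split=> //; have := gap kS k0S; rewrite -/z; lra.
  - by exists j, k; split.
  - exists j0, k0; split=> //.
    have := gap kS k0S; have := gap j0S jS; rewrite -/z; lra.
  - exists j0, k; split=> //; have := gap j0S jS; rewrite -/z; lra.
have [p0 c0 h1 h2] := price_cost j'P k'D pp; have d0 := d_ge0.
have F0 := wtp_cdf_ge0 M tau p; have F1 := wtp_cdf_le1 M tau p.
have := gap j'S k'S; rewrite -/z => gap'.
have zj : y j' = z j' + d by rewrite /z /lower j'S subrK.
have zk : y k' = z k' by rewrite /z /lower (negPf k'S).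
have ub : gain z tau j k p <= gain z tau j' k' p.
  by rewrite /gain; apply: ler_wpM2l; lra.
apply: le_trans (_ : gain z tau j' k' p + d / 2 <= _); first by rewrite lerD2r.
set mu := 1 - wtp_cdf M tau p.
have [mu2|mu2] := leP (1/2) mu.
  apply: le_trans (gain_le_dual_type y j'P k'D pp).
  rewrite /gain zj zk -/mu.
  suff : d / 2 <= mu * d by lra.
  have : 0 <= (mu - 1/2) * d by apply: mulr_ge0; lra.
  lra.
(* If fewer than half accept [p], post [pmin], which everyone accepts: with prices and costs at most
   1 and a gap of at least 2, this pays for [d / 2]. *)
have pm : pmin M tau <= pmin M tau <= pmax M tau by rewrite lexx pmin_le_pmax.
apply: le_trans (gain_le_dual_type y j'P k'D pm).
rewrite /gain zj zk -/mu (cdf_pmin (Mreg tau)) subr0 mul1r.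
have := pmin_ge0 Mok tau => pm0.
apply: le_trans (_ : (1/2) * (p - cost M j' tau k' + z j' - z k') + d / 2 <= _).
  by rewrite lerD2r; apply: ler_wpM2r; lra.
lra.
Qed.

(** For a type that does not cross, a pair on one side of the gap is unaffected, and a move from
    outside [S] into [S] is charged at least 2, so it gains nothing under [z]. *)
Lemma dual_type_lower_le tau : dual_type z tau <= dual_type y tau.
Proof.
have d0 := d_ge0.
case: (boolP (crossing S tau)) => [/dual_type_lower_crossing|ncr]; first lra.
apply: dual_type_le => j k p jP kD pp.
have F0 := wtp_cdf_ge0 M tau p; have F1 := wtp_cdf_le1 M tau p.
have [p0 c0 h1 h2] := price_cost jP kD pp.
have same : z j - z k = y j - y k -> gain z tau j k p <= dual_type y tau.
  move=> e; apply: le_trans (gain_le_dual_type y jP kD pp).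
  by rewrite /gain -!addrA -/(_ - _) e.
case: (boolP (j \in S)) => jS; case: (boolP (k \in S)) => kS.
- by apply: same; rewrite /z /lower jS kS /=; lra.
- case/negP: ncr; apply/andP; split; apply/exists_inP; [by exists j|by exists k].
- apply: le_trans (dual_type_ge0 y tau).
  have := gap kS jS; rewrite -/z => gap'.
  by rewrite /gain mulr_ge0_le0//; lra.
- by apply: same; rewrite /z /lower (negPf jS) (negPf kS).
Qed.

Lemma connectedness_le i l : i \in S -> l \notin S ->
  connectedness M <= \sum_(tau | crossing S tau) phi M tau.
Proof.
move=> iS lS; apply: (bigmin_le_cond _ (fun S => \sum_(tau | crossing S tau) phi M tau)).
apply/andP; split; first by apply/card_gt0P; exists i.
rewrite ltn_neqAle max_card andbT; apply/negP => /eqP e.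
have := subset_cardP e (fintype.subset_predT _) => /(_ l).
by rewrite (negPf lS).
Qed.

(** Each crossing type contributes [d / 2], and the crossing types have total rate at least the
    connectedness. *)
Lemma dual_lower i l : i \in S -> l \notin S ->
  dual z + connectedness M / 2 * d <= dual y.
Proof.
move=> iS lS; have d0 := d_ge0; rewrite /dual.
apply: le_trans (_ : \sum_tau phi M tau *
    (dual_type z tau + (if crossing S tau then d / 2 else 0)) <= _); last first.
  apply: ler_sum => tau _; apply: ler_wpM2l; first exact: phi_ge0 Mok tau.
  case: ifP => [/dual_type_lower_crossing//|_].
  by rewrite addr0 dual_type_lower_le.
under [leRHS]eq_bigr do rewrite mulrDr.
rewrite big_split /= lerD2l.
rewrite (eq_bigr (fun tau =>
  if crossing S tau then phi M tau * (d / 2) else 0)); last first.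
  by move=> tau _; case: ifP => // _; rewrite mulr0.
rewrite -big_mkcond /= -mulr_suml -mulrA (mulrC _^-1) ler_wpM2r//.
  by rewrite divr_ge0.
exact: connectedness_le iS lS.
Qed.

End LowerUpperSet.

(** * Contraction of a price vector to spread at most 2 m *)

Definition big_gap_below (y : V -> R) : {set V} :=
  [set i | [exists l, y l < y i] && [forall l, (y l < y i) ==> (y l + 2 < y i)]]%SET.

(** Induction on the number of nodes with a smaller value: without big gaps, each step down to a
    smaller value costs at most 2 and lowers that number. *)
Lemma big_gap_below0_spread (y : V -> R) a b : big_gap_below y = finset.set0 ->
  y a - y b <= 2 * #|V|%:R.
Proof.
move=> nogap.
suff H : forall n i, (#|[set l | (y l < y i)%R]%SET| < n)%N ->
    y i <= y b + 2 * #|[set l | y l < y i]%SET|%:R.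
  have := H _ a (ltnSn _).
  have : #|[set l | y l < y a]%SET|%:R <= #|V|%:R :> R.
    by rewrite ler_nat max_card.
  lra.
elim=> // n IH i; rewrite ltnS => cn.
have [le|lt] := leP (y i) (y b); first by apply: (le_trans le); rewrite lerDl mulr_ge0.
have : i \notin big_gap_below y by rewrite nogap inE.
rewrite !inE negb_and => /orP[/existsPn/(_ b)|]; first by rewrite lt.
move=> /forallPn[l]; rewrite negb_imply -leNgt => /andP[li il].
have sub : [set k | y k < y l]%SET \proper [set k | y k < y i]%SET.
  apply/properP; split.
    by apply/fintype.subsetP => k; rewrite !inE => /lt_trans; apply.
  by exists l; rewrite !inE ?ltxx.
have cl := proper_card sub.
have := IH l (leq_trans cl cn).
have : #|[set k | y k < y l]%SET|%:R + 1 <= #|[set k | y k < y i]%SET|%:R :> R.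
  by rewrite natr1 ler_nat.
lra.
Qed.

Hypothesis conn : 0 < connectedness M.

(* Shrinking to 2, one after the other, the gaps larger than 2 between
   consecutive values of y. *)
Lemma dual_contract (y : V -> R) : exists z : V -> R,
  [/\ forall a b, z a - z b <= 2 * #|V|%:R, dual z <= dual y &
      forall a b, dual z + connectedness M / 2 * (y a - y b - 2 * #|V|%:R) <= dual y].
Proof.
have [n] := ubnP #|big_gap_below y|; elim: n y => // n IH y; rewrite ltnS => cn.
have [e|/finset.set0Pn[i iB]] := eqVneq (big_gap_below y) finset.set0.
  exists y; split=> // a b; first exact: big_gap_below0_spread.
  rewrite gerDl mulr_ge0_le0//; first by rewrite divr_ge0// ltW.
  by have := big_gap_below0_spread a b e; lra.
move: (iB); rewrite inE => /andP[/existsP[l0 l0i] /forallP gapi].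
(* [b] is a highest node below [i]; lowering by [d] everything from [i] upwards closes the gap
   between them to exactly 2. *)
pose b := [arg max_(l > l0 | y l < y i) y l]%O.
have [bi bmax] : y b < y i /\ forall l, y l < y i -> y l <= y b.
  by rewrite /b; case: arg_maxP.
pose S := [set l | y i <= y l]%SET; pose d := y i - y b - 2.
have d0 : 0 < d by have := gapi b; rewrite bi /= /d; lra.
have SN l : l \notin S -> y l <= y b by rewrite inE -ltNge => /bmax.
have Sy l : l \in S -> y b + d + 2 <= y l by rewrite inE /d; lra.
pose z := lower y S d.
have zS l : l \in S -> z l = y l - d by rewrite /z /lower => ->.
have zN l : l \notin S -> z l = y l by rewrite /z /lower => /negPf ->.
have gap l k : l \in S -> k \notin S -> 2 <= z l - z k.
  by move=> lS kS; rewrite zS// zN//; have := SN k kS; have := Sy l lS; lra.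
have iS : i \in S by rewrite inE.
have bS : b \notin S by rewrite inE -ltNge.
have dz : dual z + connectedness M / 2 * d <= dual y.
  exact: dual_lower (ltW d0) gap _ _ iS bS.
have [|z' [sp' le' c']] := IH z.
  (* The induction measure drops: lowering preserves the order of values and widens no gap, and [i]
     no longer sits above a gap larger than 2. *)
  rewrite (leq_trans _ cn)//; apply: proper_card; apply/properP; split; last first.
    exists i => //; rewrite inE negb_and; apply/orP; right; apply/forallPn; exists b.
    by rewrite negb_imply -leNgt (zS i)// (zN b)// /d; apply/andP; split; lra.
  apply/fintype.subsetP => l; rewrite !inE => /andP[/existsP[k kl] /forallP gl].
  have mono p q : y p < y q -> z p < z q /\ z q - z p <= y q - y p.
    move=> pq; case: (boolP (p \in S)) => pS; case: (boolP (q \in S)) => qS.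
    - by rewrite !zS//; split; lra.
    - by have := SN q qS; have := Sy p pS; lra.
    - by have := gap q p qS pS; rewrite (zS q)// (zN p)//; split; lra.
    - by rewrite !zN//; split; lra.
  have anti p q : z p < z q -> y p < y q.
    move=> pq; case: (ltgtP (y p) (y q)) => //; first by move=> /mono[]; lra.
    move=> e; move: pq; case: (boolP (p \in S)) => pS; case: (boolP (q \in S)) => qS.
    - by rewrite !zS// e ltxx.
    - by have := SN q qS; have := Sy p pS; lra.
    - by have := SN p pS; have := Sy q qS; lra.
    - by rewrite !zN// e ltxx.
  apply/andP; split; first by apply/existsP; exists k; exact: anti.
  apply/forallP => p; apply/implyP => pl; have [zpl zz] := mono _ _ pl.
  by have := gl p; rewrite zpl /=; lra.
exists z'; split=> // [|p q].
  apply: le_trans le' _; apply: le_trans dz; rewrite lerDl.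
  by rewrite mulr_ge0// ?divr_ge0// ltW.
(* One lowering reduces any difference by at most [d], and [dz] has already paid for that amount. *)
have := c' p q; have : y p - y q <= z p - z q + d.
  rewrite /z /lower; case: (p \in S); case: (q \in S); lra.
set c := connectedness M / 2 in dz *.
have c0 : 0 <= c by rewrite divr_ge0// ltW.
move=> h; have : c * (y p - y q - 2 * #|V|%:R) <= c * (z p - z q - 2 * #|V|%:R) + c * d.
  by rewrite -mulrDr; apply: ler_wpM2l => //; lra.
lra.
Qed.

End Dual.

(** * Expectations given the seed, telescoping and weak duality *)

Section ConditionalExpectation.
Context {R : realType} {V Tau : finType} (M : market R V Tau).
Hypotheses (Mok : market_ok M) (Mreg : regular M).
Variables (pi : policy R V Tau) (w : seed pi) (q1 : state (V := V)).

Definition acceptance (obs : seq (Tau * bool)) (tau : Tau) : R :=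
  1 - wtp_cdf M tau (price (act_after w q1 obs tau)).

Definition state_after (obs : seq (Tau * bool)) : state (V := V) :=
  current q1 (history w q1 obs).

Definition cond_mean (t : nat) (X : seq (Tau * bool) -> R) : R :=
  \sum_(obs : t.-tuple (Tau * bool)) obs_prob M w q1 obs * X obs.

Definition cond_payoff (t : nat) : R :=
  cond_mean t (fun obs => last_payoff M (history w q1 obs)).

Lemma acceptance_ge0 obs tau : 0 <= acceptance obs tau.
Proof. by rewrite subr_ge0 wtp_cdf_le1. Qed.

Lemma acceptance_le1 obs tau : acceptance obs tau <= 1.
Proof. by rewrite gerBl wtp_cdf_ge0. Qed.

Lemma obs_prob_ge0 obs : 0 <= obs_prob M w q1 obs.
Proof.
elim: obs => [|[tau a] obs IH] /=; first exact: ler01.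
rewrite mulr_ge0// ?mulr_ge0// ?(phi_ge0 Mok)//.
by case: a; [exact: acceptance_ge0|exact: wtp_cdf_ge0].
Qed.

Lemma cond_mean0 X : cond_mean 0 X = X [::].
Proof.
rewrite /cond_mean (bigD1 [tuple])//= big1 ?addr0 ?mul1r// => o.
by rewrite (tuple0 o) => /eqP.
Qed.

(** Tower rule: the head of the list is the latest period, and its type and response are averaged
    first. *)
Lemma cond_meanS t X : cond_mean t.+1 X =
  cond_mean t (fun obs => \sum_tau phi M tau *
    (acceptance obs tau * X ((tau, true) :: obs) +
     (1 - acceptance obs tau) * X ((tau, false) :: obs))).
Proof.
rewrite /cond_mean (reindex (fun p : (Tau * bool) * t.-tuple (Tau * bool) =>
  [tuple of p.1 :: p.2])) /=; last first.
  exists (fun o => (thead o, [tuple of behead o])) => [[x o] _|o _] /=.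
    by congr pair; apply: val_inj.
  by apply: val_inj; case/tupleP: o.
rewrite -(pair_big predT predT (fun x (o : t.-tuple (Tau * bool)) =>
  obs_prob M w q1 (x :: o) * X (x :: o))) /= exchange_big /=.
apply: eq_bigr => o _.
rewrite (eq_bigr (fun p => obs_prob M w q1 ((p.1, p.2) :: o) *
  X ((p.1, p.2) :: o))); last by case.
rewrite -(pair_big predT predT (fun tau a =>
  obs_prob M w q1 ((tau, a) :: o) * X ((tau, a) :: o))) /= mulr_sumr.
apply: eq_bigr => tau _; rewrite big_bool /= /acceptance; ring.
Qed.

Lemma cond_mean_le t X Y :
  (forall obs, size obs = t -> X obs <= Y obs) -> cond_mean t X <= cond_mean t Y.
Proof.
move=> H; apply: ler_sum => o _; apply: ler_wpM2l; first exact: obs_prob_ge0.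
by apply: H; rewrite size_tuple.
Qed.

Lemma eq_cond_mean t X Y : X =1 Y -> cond_mean t X = cond_mean t Y.
Proof. by move=> e; apply: eq_bigr => o _; rewrite e. Qed.

Lemma cond_meanD t X Y :
  cond_mean t (fun obs => X obs + Y obs) = cond_mean t X + cond_mean t Y.
Proof. by rewrite -big_split; apply: eq_bigr => o _; rewrite mulrDr. Qed.

Lemma cond_mean_cst t c : cond_mean t (fun=> c) = c.
Proof.
elim: t => [|t IH]; first by rewrite cond_mean0.
rewrite cond_meanS -[RHS]IH; apply: eq_cond_mean => obs.
under eq_bigr do rewrite -mulrDl subrKC mul1r.
by rewrite -mulr_suml (phi_sum1 Mok) mul1r.
Qed.

(** The payoff minus the increase of [Phi] when the demand accepts. A declined demand changes
    neither, so [cond_step] needs only this branch. *)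
Definition shifted_payoff (Phi : state (V := V) -> R) q tau (a : action (V:=V)) : R :=
  if assign a is Some (j, k)
  then price a - cost M j tau k - (Phi (move q j k) - Phi q) else 0.

Definition cond_step (Phi : state (V := V) -> R) obs : R :=
  \sum_tau phi M tau * (acceptance obs tau *
    shifted_payoff Phi (state_after obs) tau (act_after w q1 obs tau)).

Lemma cond_payoff_telescope Phi T :
  \sum_(1 <= t < T.+1) cond_payoff t =
  \sum_(0 <= t < T) cond_mean t (cond_step Phi) +
  (cond_mean T (Phi \o state_after) - Phi q1).
Proof.
elim: T => [|T IH]; first by rewrite !big_geq// cond_mean0 add0r /= subrr.
rewrite big_nat_recr//= IH [in RHS]big_nat_recr//= -!addrA; congr (_ + _).
(* Index shift: the payoff of period [T.+1] is decided after [T] observations, so it matches the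
   step conditioned on [T] of them plus the expected increase of [Phi]. *)
suff -> : cond_payoff T.+1 = cond_mean T (cond_step Phi) +
    cond_mean T.+1 (Phi \o state_after) - cond_mean T (Phi \o state_after) by ring.
apply/eqP; rewrite eq_sym subr_eq eq_sym; apply/eqP.
rewrite /cond_payoff !cond_meanS -!cond_meanD; apply: eq_cond_mean => obs.
have {1}-> : (Phi \o state_after) obs =
    \sum_tau phi M tau * Phi (state_after obs).
  by rewrite -mulr_suml (phi_sum1 Mok) mul1r.
rewrite /cond_step -!big_split /=; apply: eq_bigr => tau _.
rewrite -!mulrDr; congr (_ * _).
rewrite /state_after /= /payoff /after /shifted_payoff /= -/(act_after w q1 obs tau).
by case: (assign _) => [[j k]|] /=; ring.
Qed.

Lemma cond_payoff_sum_le Phi c D T : (forall obs, cond_step Phi obs <= c) ->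
  (forall obs, Phi (state_after obs) - Phi q1 <= D) ->
  \sum_(1 <= t < T.+1) cond_payoff t <= T%:R * c + D.
Proof.
move=> Hc HD; rewrite (cond_payoff_telescope Phi) lerD//; last first.
  rewrite -[X in _ - X](cond_mean_cst T) -[leRHS](cond_mean_cst T) lerBlDr.
  by rewrite -cond_meanD; apply: cond_mean_le => obs _; rewrite -lerBlDr HD.
rewrite [leRHS]mulr_natl -[in leRHS](subn0 T) -sumr_const_nat.
apply: ler_sum => t _; rewrite -[leRHS](cond_mean_cst t).
by apply: cond_mean_le => obs _.
Qed.

Lemma cond_payoff_sum_ge Phi c D T : (forall obs, c <= cond_step Phi obs) ->
  (forall obs, D <= Phi (state_after obs) - Phi q1) ->
  T%:R * c + D <= \sum_(1 <= t < T.+1) cond_payoff t.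
Proof.
move=> Hc HD; rewrite (cond_payoff_telescope Phi) lerD//; last first.
  rewrite -[X in _ - X](cond_mean_cst T) -[leLHS](cond_mean_cst T) lerBrDr.
  by rewrite -cond_meanD; apply: cond_mean_le => obs _; rewrite -lerBrDr HD.
rewrite [leLHS]mulr_natl -[in leLHS](subn0 T) -sumr_const_nat.
apply: ler_sum => t _; rewrite -[leLHS](cond_mean_cst t).
by apply: cond_mean_le => obs _.
Qed.

Hypothesis feas : feasible M pi.

(** A nonempty queue at [j] makes the truncated subtraction in [move] exact; [j = k] is allowed. *)
Lemma sum_move (q : state (V := V)) j k (y : V -> R) : (0 < q j)%N ->
  \sum_i y i * (move q j k i)%:R = \sum_i y i * (q i)%:R - y j + y k.
Proof.
move=> qj.
have H i : y i * (move q j k i)%:R =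
    y i * (q i)%:R - (if i == j then y i else 0) + (if i == k then y i else 0).
  rewrite ffunE natrD natrB; last by case: eqP => // ->.
  by case: (i == j); case: (i == k) => /=; ring.
by under eq_bigr do rewrite H; rewrite !big_split /= sumrN -!big_mkcond !big_pred1_eq.
Qed.

Lemma move_Omega K (q : state (V := V)) j k : (0 < q j)%N ->
  Omega_ K q -> Omega_ K (move q j k).
Proof.
move=> qj; rewrite /Omega_ /= => qK; apply/eqP.
rewrite -(eqr_nat R).
have mul1 (q' : state (V := V)) : \sum_i 1 * (q' i)%:R = (\sum_i q' i)%:R :> R.
  by rewrite natr_sum; apply: eq_bigr => i _; rewrite mul1r.
by have := sum_move k (fun=> 1) qj; rewrite !mul1 qK subrK => ->.
Qed.

Lemma state_after_Omega K obs : Omega_ K q1 -> Omega_ K (state_after obs).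
Proof.
move=> q1K; elim: obs => [//|[tau a] obs IH].
rewrite /state_after /= /after /=; case: a => //.
case E : (assign _) => [[j k]|]//; apply: move_Omega => //.
by have [] := assign_feasible feas E.
Qed.

(** Weak duality, with the linear potential of weights [y]: each shifted step is one of the gains
    bounded by the dual, and the potential varies by at most [B] per supply unit. *)
Lemma cond_payoff_le_dual (i0 : V) K (y : V -> R) B T : Omega_ K q1 ->
  (forall i l, y i - y l <= B) ->
  \sum_(1 <= t < T.+1) cond_payoff t <= T%:R * dual M y + B * K%:R.
Proof.
move=> q1K yB.
apply: (@cond_payoff_sum_le (fun q => \sum_i y i * (q i)%:R)) => obs.
  apply: ler_sum => tau _; apply: ler_wpM2l; first exact: phi_ge0 Mok tau.
  rewrite /shifted_payoff; case E : (assign _) => [[j k]|]; last first.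
    by rewrite mulr0 dual_type_ge0.
  have [jP kD qj] := assign_feasible feas E.
  have pp := price_feasible feas w (history w q1 obs) (state_after obs) tau.
  have := gain_le_dual_type Mok y jP kD pp; apply: le_trans.
  rewrite sum_move// /gain /acceptance /act_after -/(state_after obs).
  by rewrite le_eqVlt; apply/orP; left; apply/eqP; ring.
have mean (q : state (V := V)) (c : R) : Omega_ K q ->
    \sum_i c * (q i)%:R = c * K%:R.
  by rewrite /Omega_ /= => <-; rewrite natr_sum mulr_sumr.
(* Relative to the least weight [y l], every weight lies in [[0, B]], and both states hold [K] units
   in total. *)
pose l := [arg min_(i < i0) y i]%O.
have lmin i : y l <= y i by rewrite /l; case: arg_minP => // i1 _; apply.
have lb : y l * K%:R <= \sum_i y i * (q1 i)%:R.
  by rewrite -(mean q1)//; apply: ler_sum => i _; rewrite ler_wpM2r.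
have ub : \sum_i y i * (state_after obs i)%:R <= (y l + B) * K%:R.
  rewrite -(mean (state_after obs)); last exact: state_after_Omega.
  by apply: ler_sum => i _; rewrite ler_wpM2r//; have := yB i l; lra.
lra.
Qed.

End ConditionalExpectation.

(** * The square-root potential: second-order expansion and range *)

Section Potential.
Context {R : realType} {V : finType}.
Variable K : nat.
Hypothesis K_gt0 : (0 < K)%N.

Let m : R := #|V|%:R.
Let s : R := Num.sqrt K%:R.
Let Kt : R := K%:R + m * s.

Definition potential (q : state (V := V)) : R :=
  - (2 * Num.sqrt m * Kt) * \sum_i Num.sqrt (qbar K q i).

Let s_gt0 : 0 < s. Proof. by rewrite sqrtr_gt0 ltr0n. Qed.

Let sE : s ^+ 2 = K%:R. Proof. by rewrite sqr_sqrtr. Qed.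

Let m_ge0 : 0 <= m. Proof. exact: ler0n. Qed.

Let KtE : Kt = s * (s + m). Proof. by rewrite /Kt -sE; ring. Qed.

Let Kt_gt0 : 0 < Kt.
Proof. by rewrite KtE mulr_gt0// ltr_wpDr. Qed.

Lemma qbar_gt0 (q : state (V := V)) i : 0 < qbar K q i :> R.
Proof. by rewrite /qbar divr_gt0// ltr_wpDl. Qed.

Lemma qbar_ge0 (q : state (V := V)) i : 0 <= qbar K q i :> R.
Proof. exact: ltW (qbar_gt0 q i). Qed.

Lemma congestion_qbar (q : state (V := V)) i :
  congestion V (qbar K q i) = - (Num.sqrt m / Num.sqrt (qbar K q i)).
Proof.
by rewrite /congestion powRN powR12_sqrt ?mulNr// ltW// qbar_gt0.
Qed.

(** Tangent bound for minus twice the square root at [u ^+ 2], with an explicit quadratic error. It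
    holds for every [v >= 0], so the step need not be small compared with the queue. *)
Lemma sqrt_upper (u v : R) : 0 < u -> 0 <= v ->
  - (2 * (v - u)) <= - ((v ^+ 2 - u ^+ 2) / u) + (v ^+ 2 - u ^+ 2) ^+ 2 / u ^+ 3.
Proof.
move=> u0 v0; rewrite -subr_ge0.
rewrite (_ : _ - _ = (v - u) ^+ 2 * (v * (v + 2 * u)) / u ^+ 3); last first.
  by field; rewrite gt_eqF.
have h : 0 <= v * (v + 2 * u) by apply: mulr_ge0 => //; lra.
by apply: divr_ge0; [apply: mulr_ge0 => //; exact: sqr_ge0|rewrite exprn_ge0// ltW].
Qed.

(** [sqrt_upper] is applied at each node. The linear terms add up to the charge of the move; only
    [j] and [k] produce an error, hence the factor 2. *)
Lemma potential_move (q : state (V := V)) j k (w : R) : (0 < q j)%N ->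
  (forall i, (Num.sqrt (qbar K q i))^-1 <= w) ->
  potential (move q j k) - potential q <=
  - congestion V (qbar K q j) + congestion V (qbar K q k) +
  2 * Num.sqrt m * w ^+ 3 / Kt.
Proof.
move=> qj Hw.
pose D i : R := (move q j k i)%:R - (q i)%:R.
have -> : - congestion V (qbar K q j) + congestion V (qbar K q k) =
    \sum_i congestion V (qbar K q i) * D i.
  under eq_bigr do rewrite /D mulrBr.
  by rewrite sumrB sum_move//; ring.
have H i : - (2 * Num.sqrt m * Kt) *
      (Num.sqrt (qbar K (move q j k) i) - Num.sqrt (qbar K q i)) <=
    congestion V (qbar K q i) * D i +
    Num.sqrt m * w ^+ 3 / Kt * ((i == j)%:R + (i == k)%:R).
  have u0 : 0 < Num.sqrt (qbar K q i : R) by rewrite sqrtr_gt0 qbar_gt0.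
  have v0 : 0 <= Num.sqrt (qbar K (move q j k) i : R) by exact: sqrtr_ge0.
  have := sqrt_upper u0 v0; rewrite !sqr_sqrtr ?qbar_ge0//.
  have -> : qbar K (move q j k) i - qbar K q i = D i / Kt.
    by rewrite /qbar /D -/m -/s -/Kt; field; rewrite gt_eqF.
  rewrite congestion_qbar; have := Hw i.
  set u := Num.sqrt (qbar K q i); set v := Num.sqrt _ => uw h.
  have mKt : 0 <= Num.sqrt m * Kt by rewrite mulr_ge0 ?sqrtr_ge0// ltW.
  have := ler_wpM2l mKt h.
  move=> h1; apply: le_trans (_ : Num.sqrt m * Kt * - (2 * (v - u)) <= _).
    by rewrite le_eqVlt; apply/orP; left; apply/eqP; ring.
  apply: (le_trans h1).
  rewrite (_ : Num.sqrt m * Kt * _ = - (Num.sqrt m / u) * D i +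
      Num.sqrt m * u^-1 ^+ 3 / Kt * D i ^+ 2); last first.
    by field; rewrite !gt_eqF.
  rewrite lerD2l; apply: ler_pM.
  - by rewrite divr_ge0 ?mulr_ge0 ?sqrtr_ge0 ?exprn_ge0 ?invr_ge0// ltW.
  - exact: sqr_ge0.
  - apply: ler_wpM2r; first by rewrite invr_ge0 ltW.
    apply: ler_wpM2l; first exact: sqrtr_ge0.
    by rewrite lerXn2r// nnegrE ?invr_ge0 ?(ltW u0)// (le_trans _ uw)// invr_ge0 ltW.
  (* The increment is -1, 0 or 1 and vanishes when [j = k]. *)
  - rewrite /D ffunE natrD natrB; last by case: eqP => // ->.
    by case: (i == j); case: (i == k) => /=; lra.
rewrite /potential -mulrBr -sumrB mulr_sumr.
apply: le_trans (ler_sum _ (fun i _ => H i)) _.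
rewrite big_split lerD2l -mulr_sumr big_split /=.
have sum1 (x : V) : \sum_i (i == x)%:R = 1 :> R.
  by rewrite (bigD1 x)//= eqxx big1 ?addr0// => i /negPf ->.
by rewrite !sum1 le_eqVlt; apply/orP; left; apply/eqP; ring.
Qed.

Lemma sum_qbar (q : state (V := V)) : Omega_ K q -> \sum_i qbar K q i = 1 :> R.
Proof.
rewrite /Omega_ /= => qK; rewrite /qbar -mulr_suml big_split /= -natr_sum qK.
by rewrite sumr_const -[X in _ + X]mulr_natl -/m -/s -/Kt divff// gt_eqF.
Qed.

Lemma potential_le0 q : potential q <= 0.
Proof.
rewrite /potential mulNr oppr_le0 mulr_ge0//; last first.
  by apply: sumr_ge0 => i _; exact: sqrtr_ge0.
by rewrite !mulr_ge0 ?sqrtr_ge0// ltW.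
Qed.

Lemma potential_ge (q : state (V := V)) : Omega_ K q -> - (2 * m * Kt) <= potential q.
Proof.
move=> qK; rewrite /potential mulNr lerN2.
(* [V] may be empty here, and then both sides are 0; otherwise one divides by [Num.sqrt m]. *)
have [m0|m0] := eqVneq m 0.
  by rewrite m0 sqrtr0 !(mulr0, mul0r).
have m1 : 0 < m by rewrite lt_neqAle eq_sym m0 m_ge0.
have sm : 0 < Num.sqrt m by rewrite sqrtr_gt0.
have smE : Num.sqrt m ^+ 2 = m by rewrite sqr_sqrtr.
suff H : \sum_i Num.sqrt (qbar K q i) <= Num.sqrt m.
  have c0 : 0 <= 2 * Num.sqrt m * Kt by rewrite !mulr_ge0 ?sqrtr_ge0// ltW.
  apply: le_trans (ler_wpM2l c0 H) _.
  by rewrite -[X in 2 * X * Kt]smE le_eqVlt; apply/orP; left; apply/eqP; ring.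
(* AM-GM at the uniform state: sqrt x <= (sqrt m * x + 1 / sqrt m) / 2 *)
have H i : Num.sqrt (qbar K q i) <= (Num.sqrt m * qbar K q i + (Num.sqrt m)^-1) / 2.
  set x := Num.sqrt (qbar K q i).
  have xE : qbar K q i = x ^+ 2 by rewrite sqr_sqrtr// ltW// qbar_gt0.
  rewrite xE -subr_ge0 (_ : _ - _ = (Num.sqrt m * x - 1) ^+ 2 / (2 * Num.sqrt m)).
    by rewrite divr_ge0 ?sqr_ge0// mulr_ge0// ltW.
  by field; rewrite gt_eqF.
apply: le_trans (ler_sum _ (fun i _ => H i)) _.
rewrite -mulr_suml big_split /= -mulr_sumr sum_qbar// sumr_const -[X in _ + X]mulr_natl.
have -> : #|V|%:R / Num.sqrt m = Num.sqrt m.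
  by rewrite -/m -[X in X / _]smE expr2 mulfK ?gt_eqF.
lra.
Qed.

End Potential.

(** * Elementary inequalities comparing the loss with the slack of the dual *)

(* W stands for max_j qbar_j^(-1/2) and x for the loss of MBP on one demand
   type: a second-order term if it is served, at most 1 if it is dropped. *)
Section LossBound.
Context {R : realFieldType} (alpha m s r W x : R).
Hypotheses (alpha_gt0 : 0 < alpha) (r_gt1 : 1 < r) (rE : r ^+ 2 = m)
  (sm : 16 * m < s) (s_alpha : 16 / alpha <= s) (s_alpha2 : 64 / alpha ^+ 2 <= s)
  (W_gt0 : 0 < W) (W2 : W ^+ 2 <= s + m)
  (x_le : x <= 2 * r * W ^+ 3 / (s * (s + m)) \/ x <= 1 /\ s + m <= W ^+ 2).

Let r_gt0 : 0 < r. Proof. exact: lt_trans r_gt1. Qed.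
Let m_gt0 : 0 < m. Proof. by rewrite -rE exprn_gt0. Qed.
Let s_gt0 : 0 < s. Proof. by apply: lt_trans sm; rewrite mulr_gt0. Qed.

(** The second-order term is largest at [W = 4 * r], which gives the constant 128. A drop would
    force [s + m <= 16 * m], against [sm]. *)
Lemma loss_balanced : W <= 4 * r -> x <= 128 * m ^+ 2 / s ^+ 2.
Proof.
move=> W4; have W16 : W ^+ 2 <= 16 * m.
  rewrite -rE (_ : 16 * r ^+ 2 = (4 * r) ^+ 2); last by ring.
  by rewrite lerXn2r// nnegrE ltW// mulr_gt0.
case: x_le => [/le_trans|[_ smW]]; last by have := m_gt0; have := sm; lra.
apply; apply: le_trans (_ : 2 * r * (4 * r) ^+ 3 / (s * (s + m)) <= _).
  apply: ler_wpM2r; first by rewrite invr_ge0 ltW// mulr_gt0// addr_gt0.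
  apply: ler_wpM2l; first by rewrite mulr_ge0// ltW.
  by rewrite lerXn2r// nnegrE ltW// mulr_gt0.
rewrite (_ : 2 * r * (4 * r) ^+ 3 = 128 * m ^+ 2); last by rewrite -rE; ring.
apply: ler_wpM2l; first by rewrite mulr_ge0// exprn_ge0// ltW.
by rewrite lef_pV2 ?posrE ?exprn_gt0 ?mulr_gt0 ?addr_gt0// expr2 ler_wpM2l ?lerDl// ltW.
Qed.

(** Since [r * W >= 4 * m], the slack is at least [alpha / 8 * (r * W)]. The second-order term is at
    most [2 * (r * W) / s], which [s_alpha] controls; a drop forces [W >= 8 / alpha], so the slack
    is at least 1. *)
Lemma loss_unbalanced d : 4 * r < W -> r * W - m <= d ->
  x <= alpha / 2 * (d - 2 * m).
Proof.
move=> W4 dW; have rW : 4 * m <= r * W.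
  rewrite -rE (_ : 4 * r ^+ 2 = r * (4 * r)); last by ring.
  by rewrite ler_wpM2l// ltW.
apply: (@le_trans _ _ (alpha / 8 * (r * W))); last first.
  rewrite (_ : alpha / 8 * (r * W) = alpha / 2 * (r * W / 4)); last by field.
  by apply: ler_wpM2l; [rewrite divr_ge0// ltW|move: dW rW; lra].
case: x_le => [/le_trans|[x1 smW]].
  apply.
  have -> : 2 * r * W ^+ 3 / (s * (s + m)) = 2 * (r * W) * (W ^+ 2 / (s * (s + m))).
    by ring.
  have WKt : W ^+ 2 / (s * (s + m)) <= alpha / 16.
    rewrite ler_pdivrMr; last by rewrite mulr_gt0// addr_gt0.
    apply: (le_trans W2); rewrite mulrA ler_peMl//; first by rewrite addr_ge0// ltW.
    by move: s_alpha; rewrite ler_pdivrMr//; lra.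
  have rW0 : 0 <= 2 * (r * W) by rewrite !mulr_ge0// ltW.
  by have := ler_wpM2l rW0 WKt; lra.
apply: (le_trans x1).
have : 8 / alpha <= W.
  rewrite -(@ler_pXn2r _ 2) ?nnegrE ?divr_ge0 ?(ltW W_gt0) ?(ltW alpha_gt0)//.
  by rewrite exprMn exprVn; apply: le_trans smW; have := s_alpha2; have := m_gt0; lra.
rewrite ler_pdivrMr// mulrC => aW.
have : alpha * W <= alpha * W * r by rewrite ler_peMr ?(ltW r_gt1)// mulr_ge0// ltW.
by move: aW; lra.
Qed.

End LossBound.

(** * One-period performance of MBP against the dual *)

Section Drift.
Context {R : realType} {V Tau : finType} (M : market R V Tau).
Hypotheses (Mok : market_ok M) (Mreg : regular M) (conn : 0 < connectedness M)
  (V_gt1 : (1 < #|V|)%N).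
Variable K : nat.

Let m : R := #|V|%:R.
Let s : R := Num.sqrt K%:R.
Let Kt : R := K%:R + m * s.
Let alpha := connectedness M.

Hypothesis s_large : 16 * m + 1 + 16 / alpha + 64 / alpha ^+ 2 <= s.

Let m_gt1 : 1 < m. Proof. by rewrite ltr1n. Qed.
Let a_gt0 : 0 < alpha. Proof. exact: conn. Qed.
Let s_gt : 16 * m < s /\ 16 / alpha <= s /\ 64 / alpha ^+ 2 <= s.
Proof.
have : 0 < 16 / alpha by rewrite divr_gt0.
have : 0 < 64 / alpha ^+ 2 by rewrite divr_gt0// exprn_gt0.
by have := s_large; have := m_gt1; split; [|split]; lra.
Qed.
Let s_gt0 : 0 < s. Proof. by have [] := s_gt; have := m_gt1; lra. Qed.

Lemma large_gt0 : (0 < K)%N.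
Proof. by have := s_gt0; rewrite sqrtr_gt0 ltr0n. Qed.

Let K_gt0 := large_gt0.
Let sE : s ^+ 2 = K%:R. Proof. by rewrite sqr_sqrtr. Qed.
Let KtE : Kt = s * (s + m). Proof. by rewrite /Kt -sE; ring. Qed.
Let Kt_gt0 : 0 < Kt.
Proof. by rewrite KtE mulr_gt0//; have := s_gt0; have := m_gt1; lra. Qed.

(** If the demand is served, the pair and the rate chosen by MBP attain the dual at [y], so only the
    curvature of the potential is lost. If it is dropped, the best pair starts at an empty queue, so
    its charge is nonnegative and no gain exceeds 1. *)
Lemma MBP_gain (pi : policy R V Tau) (w : seed pi) q1 obs tau (W : R) :
  feasible M pi -> is_MBP M (congestion V) K pi -> Omega_ K (state_after w q1 obs) ->
  let q := state_after w q1 obs in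
  let y := fun i => congestion V (qbar K q i) in
  (forall i, (Num.sqrt (qbar K q i))^-1 <= W) ->
  dual_type M y tau -
    acceptance M w q1 obs tau *
    shifted_payoff M (potential K) q tau (act_after w q1 obs tau)
  <= 2 * Num.sqrt m * W ^+ 3 / Kt \/
  (dual_type M y tau -
    acceptance M w q1 obs tau *
    shifted_payoff M (potential K) q tau (act_after w q1 obs tau)
  <= 1 /\ s + m <= W ^+ 2).
Proof.
move=> feas mbp qK q y HW.
have [j [k [jP kD best]]] := mbp w (history w q1 obs) q tau qK.
rewrite /shifted_payoff /acceptance /act_after -/(state_after w q1 obs) -/q.
case: ifPn => [qj [-> [mu [mu01 mumax ->]]]|].
  left; have [pp ->] := price_ofP Mreg tau mu01.
  have ub : dual_type M y tau <= mu * (price_of M tau mu - cost M j tau k + y j - y k).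
    apply: (dual_type_le Mok Mreg) => j' k' p j'P k'D p01.
    have F0 := wtp_cdf_ge0 M tau p; have F1 := wtp_cdf_le1 M tau p.
    have := mumax (1 - wtp_cdf M tau p); rewrite /revenue price_of_accept//.
    have := best _ _ j'P k'D; rewrite -!/(y _) => b1 b2.
    apply: (@le_trans _ _ ((1 - wtp_cdf M tau p) * (p - cost M j tau k + y j - y k))).
      by rewrite /gain; apply: ler_wpM2l; lra.
    have : 0 <= 1 - wtp_cdf M tau p <= 1 by lra.
    move/b2; lra.
  have := potential_move K_gt0 k qj HW; rewrite -/(y j) -/(y k) -/m -/s -/Kt.
  set E := _ / Kt; set dP := _ - _ => pot.
  have E0 : 0 <= E.
    apply: divr_ge0; last exact: ltW.
    apply: mulr_ge0; first by rewrite mulr_ge0 ?sqrtr_ge0.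
    by rewrite exprn_ge0// (le_trans _ (HW j))// invr_ge0 sqrtr_ge0.
  rewrite subKr.
  have mu0 : 0 <= mu by lra.
  have : mu * dP <= mu * (- y j + y k) + E.
    have := ler_wpM2l mu0 pot; have : mu * E <= E by rewrite ler_piMl//; lra.
    lra.
  lra.
rewrite -leqNgt leqn0 => /eqP qj0 ->; rewrite mulr0 subr0; right.
(* An empty queue has normalized length [s / Kt], and [Kt = s * (s + m)]. *)
have qjE : qbar K q j = (s + m)^-1 :> R.
  rewrite /qbar qj0 add0r -/m -/s -/Kt KtE invfM mulrA divff ?mul1r// gt_eqF//.
split.
  apply: (dual_type_le Mok Mreg) => j' k' p j'P k'D p01.
  have [_ _ h _] := price_cost Mok jP kD p01.
  have F0 := wtp_cdf_ge0 M tau p; have F1 := wtp_cdf_le1 M tau p.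
  have := best _ _ j'P k'D; rewrite -!/(y _) => b1.
  have yjk : y j <= y k.
    rewrite /y !congestion_qbar// lerN2 ler_wpM2l ?sqrtr_ge0//.
    rewrite lef_pV2 ?posrE ?sqrtr_gt0 ?qbar_gt0//.
    rewrite ler_sqrt ?qbar_ge0// /qbar qj0.
    apply: ler_wpM2r; first by rewrite invr_ge0 ltW.
    by rewrite lerD2r ler_nat.
  apply: le_trans (_ : (1 - wtp_cdf M tau p) * 1 <= _); last by lra.
  by rewrite /gain; apply: ler_wpM2l; lra.
have := HW j; rewrite qjE => h.
have sm0 : 0 < s + m by have := s_gt0; have := m_gt1; lra.
have v0 : 0 <= (Num.sqrt (s + m)^-1)^-1 by rewrite invr_ge0 sqrtr_ge0.
have -> : s + m = (Num.sqrt (s + m)^-1)^-1 ^+ 2.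
  by rewrite exprVn sqr_sqrtr ?invrK// invr_ge0 ltW.
by rewrite lerXn2r// nnegrE// (le_trans v0 h).
Qed.

(* Either all queues are at least of order K / m, or the imbalance of y pays for the
   curvature of the potential and for the dropped demand. *)
Lemma MBP_drift (pi : policy R V Tau) (w : seed pi) q1 obs (G : R) :
  feasible M pi -> is_MBP M (congestion V) K pi -> Omega_ K q1 ->
  (forall z : V -> R, (forall a b, z a - z b <= 2 * m) -> G <= dual M z) ->
  G - 128 * m ^+ 2 / K%:R <= cond_step M w q1 (potential K) obs.
Proof.
move=> feas mbp q1K GP.
have qK := state_after_Omega w feas obs q1K.
set q := state_after w q1 obs in qK.
pose y i : R := congestion V (qbar K q i).
have /card_gt0P[i0 _] : (0 < #|V|)%N by exact: ltnW.
pose b := [arg min_(i < i0) (qbar K q i : R)]%O.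
have bmin i : qbar K q b <= qbar K q i :> R.
  by rewrite /b; case: arg_minP => // i1 _; apply.
pose a := [arg max_(i > i0) (qbar K q i : R)]%O.
have amax i : qbar K q i <= qbar K q a :> R.
  by rewrite /a; case: arg_maxP => // i1 _; apply.
pose W : R := (Num.sqrt (qbar K q b))^-1.
have W0 : 0 < W by rewrite invr_gt0 sqrtr_gt0 qbar_gt0.
have WP i : (Num.sqrt (qbar K q i))^-1 <= W.
  rewrite /W lef_pV2 ?posrE ?sqrtr_gt0 ?qbar_gt0//.
  by rewrite ler_sqrt ?qbar_ge0.
pose r : R := Num.sqrt m.
have r1 : 1 < r by rewrite -[ltLHS]sqrtr1 ltr_sqrt// (lt_trans ltr01).
have rE : r ^+ 2 = m by rewrite sqr_sqrtr// ltW// (lt_trans ltr01).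
have yb : y b = - (r * W) by rewrite /y congestion_qbar.
(* The normalized lengths sum to 1, so the largest is at least [1 / m]. *)
have ya : - m <= y a.
  rewrite /y congestion_qbar// lerN2 -/m -/r -rE expr2 ler_wpM2l//; first lra.
  have m0 : 0 < m by rewrite (lt_trans ltr01)// m_gt1.
  have xa : m^-1 <= qbar K q a.
    rewrite -[leLHS]mul1r ler_pdivrMr// -(sum_qbar K_gt0 qK) mulr_natr -sumr_const.
    exact: ler_sum.
  rewrite -[leRHS]invrK lef_pV2 ?posrE ?sqrtr_gt0 ?qbar_gt0 ?invr_gt0//; last lra.
  by rewrite -sqrtrV ?(ltW m0)// ler_sqrt ?qbar_ge0.
have W2 : W ^+ 2 <= s + m.
  rewrite exprVn sqr_sqrtr ?qbar_ge0// /qbar invf_div.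
  rewrite ler_pdivrMr -/m -/s -/Kt ?KtE; last by rewrite ltr_wpDl.
  by rewrite mulrC ler_wpM2l ?lerDr// addr_ge0// ltW// (lt_trans ltr01).
(* The contracted vector [z] is admissible for [G], and the decrease from [dual M y] to [dual M z]
   is the slack available when [W] is large. *)
have [z [zs zle za]] := dual_contract Mok Mreg conn y.
have Gz := GP z zs; have zab := za a b.
have loss B : (forall tau, dual_type M y tau - acceptance M w q1 obs tau *
      shifted_payoff M (potential K) q tau (act_after w q1 obs tau) <= B) ->
    dual M y - B <= cond_step M w q1 (potential K) obs.
  move=> H; rewrite -[X in _ - X]mul1r -(phi_sum1 Mok) mulr_suml /dual -sumrB.
  apply: ler_sum => tau _; rewrite -mulrBr.
  apply: ler_wpM2l; first exact: phi_ge0 Mok tau.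
  by rewrite lerBlDr -lerBlDl; exact: H.
have [sm [sa sa2]] := s_gt.
have x_le tau := MBP_gain tau feas mbp qK WP.
rewrite -/m -/s -/Kt KtE -/r -/q -/y in x_le.
have [W4|W4] := leP W (4 * r).
  apply: le_trans (loss (128 * m ^+ 2 / K%:R) _); first by rewrite lerD2r (le_trans Gz).
  by move=> tau; rewrite -sE; exact: loss_balanced sm W0 (x_le tau) W4.
apply: le_trans (loss (alpha / 2 * (y a - y b - 2 * m)) _).
  rewrite lerBrDr; apply: le_trans zab; rewrite lerD2r (le_trans _ Gz)// gerBl.
  by rewrite divr_ge0 ?mulr_ge0 ?exprn_ge0.
move=> tau; apply: (loss_unbalanced a_gt0 r1 rE sm sa sa2 W0 W2 (x_le tau)) => //.
by rewrite yb opprK addrC lerD2r.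
Qed.

End Drift.

(** * Integration over the seed: measurability, and bounds that hold for every seed *)

Section Averages.
Context {R : realType} {V Tau : finType} (M : market R V Tau).
Hypotheses (Mok : market_ok M) (Mreg : regular M).
Variable pi : policy R V Tau.
Hypothesis feas : feasible M pi.

Lemma measurable_wtp_cdf tau : measurable_fun setT (wtp_cdf M tau).
Proof. by apply: nondecreasing_measurable => //; exact: wtp_cdf_homo. Qed.

Lemma measurable_obs_prob q1 obs :
  measurable_fun setT (fun w : seed pi => obs_prob M w q1 obs).
Proof.
elim: obs => [|[tau a] obs IH] /=; first exact: measurable_cst.
apply: measurable_funM; first by apply: measurable_funM => //; exact: measurable_cst.
have mF : measurable_fun setT
    (fun w : seed pi => wtp_cdf M tau (price (act_after w q1 obs tau))).
  apply: measurableT_comp; first exact: measurable_wtp_cdf.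
  exact: price_measurable feas _ _ _.
by case: a => //; apply: measurable_funB => //; exact: measurable_cst.
Qed.

(** The assignment takes finitely many values, so the payoff is a finite sum of indicators times
    affine functions of the price. *)
Lemma measurable_last_payoff q1 obs :
  measurable_fun setT (fun w : seed pi => last_payoff M (history w q1 obs)).
Proof.
case: obs => [|[tau [|]] obs]; [exact: measurable_cst| |exact: measurable_cst].
rewrite (_ : (fun w => _) = (fun w : seed pi => \sum_(jk : V * V)
    (\1_[set w' : seed pi | assign (act_after w' q1 obs tau) = Some jk] w : R) *
    (price (act_after w q1 obs tau) - cost M jk.1 tau jk.2))).
  apply: measurable_sum => jk; apply: measurable_funM.
    by apply: measurable_indic; exact: assign_measurable feas _ _ _ _.
  apply: measurable_funB; last exact: measurable_cst.
  exact: price_measurable feas _ _ _.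
apply/funext => w; rewrite /= /payoff /= -/(act_after w q1 obs tau).
case E : (assign _) => [[j k]|].
  rewrite (bigD1 (j, k))//= big1 ?addr0.
    by rewrite indicE mem_set ?mul1r//=.
  move=> jk jkE; rewrite indicE memNset ?mul0r//= E => -[e].
  by move: jkE; rewrite e eqxx.
by rewrite big1// => jk _; rewrite indicE memNset ?mul0r//= E.
Qed.

Lemma measurable_cond_payoff q1 t :
  measurable_fun setT (fun w : seed pi => cond_payoff M w q1 t).
Proof.
apply: measurable_sum => obs; apply: measurable_funM.
  exact: measurable_obs_prob.
exact: measurable_last_payoff.
Qed.

Lemma last_payoff_bound (w : seed pi) q1 obs :
  -1 <= last_payoff M (history w q1 obs) <= 1.
Proof.
case: obs => [|[tau a] obs] /=; first by lra.
rewrite /payoff /=; case: a; last by lra.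
case E : (assign _) => [[j k]|]; last by lra.
have [jP kD _] := assign_feasible feas E.
have pp := price_feasible feas w (history w q1 obs) (current q1 (history w q1 obs)) tau.
by have [_ _ h1 h2] := price_cost Mok jP kD pp; rewrite h1 h2.
Qed.

Lemma cond_payoff_bound (w : seed pi) q1 t : -1 <= cond_payoff M w q1 t <= 1.
Proof.
rewrite -[X in X <= _ <= _](cond_mean_cst Mok w q1 t).
rewrite -[X in _ <= _ <= X](cond_mean_cst Mok w q1 t).
by apply/andP; split; apply: cond_mean_le => // obs _;
  have /andP[] := last_payoff_bound w q1 obs.
Qed.

Lemma integrable_bounded_seed (f : seed pi -> R) (B : R) :
  measurable_fun setT f -> (forall w, `|f w| <= B) ->
  (seed_law pi).-integrable setT (EFin \o f).
Proof.
move=> mf fB; apply: measurable_bounded_integrable => //.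
  by apply: le_lt_trans (ltry 1); exact: probability_le1.
exists B; split; first exact: num_real.
by move=> c Bc w _; apply: le_trans (fB w) (ltW Bc).
Qed.

Lemma integrable_cond_payoff q1 t : (seed_law pi).-integrable setT
  (EFin \o (fun w : seed pi => cond_payoff M w q1 t)).
Proof.
apply: (integrable_bounded_seed (B := 1)); first exact: measurable_cond_payoff.
by move=> w; rewrite ler_norml cond_payoff_bound.
Qed.

Lemma integrable_sum_cond_payoff q1 T : (seed_law pi).-integrable setT
  (EFin \o (fun w : seed pi => \sum_(1 <= t < T.+1) cond_payoff M w q1 t)).
Proof.
apply: (integrable_bounded_seed (B := T%:R)).
  by apply: measurable_sum => t; exact: measurable_cond_payoff.
move=> w; apply: le_trans (ler_norm_sum _ _ _) _.
apply: le_trans (_ : \sum_(1 <= t < T.+1) (1 : R) <= _); last first.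
  by rewrite sumr_const_nat subn1.
by apply: ler_sum => t _; rewrite ler_norml cond_payoff_bound.
Qed.

Lemma sum_mean_payoff q1 T : \sum_(1 <= t < T.+1) mean_payoff M pi q1 t =
  Rintegral (seed_law pi) setT
    (fun w => \sum_(1 <= t < T.+1) cond_payoff M w q1 t).
Proof.
elim: T => [|T IH].
  rewrite big_geq//; under eq_Rintegral do rewrite big_geq//.
  by rewrite Rintegral_cst// mul0r.
rewrite big_nat_recr//= IH; under [RHS]eq_Rintegral do rewrite big_nat_recr//=.
rewrite RintegralD//; first exact: integrable_sum_cond_payoff.
exact: integrable_cond_payoff.
Qed.

Lemma integrable_cst_seed c : (seed_law pi).-integrable setT
  (EFin \o (fun _ : seed pi => c : R)).
Proof. by apply: (integrable_bounded_seed (B := `|c|)) => //; exact: measurable_cst. Qed.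

Lemma Rintegral_cst_seed c : Rintegral (seed_law pi) setT (fun=> c) = c.
Proof.
rewrite Rintegral_cst// [X in _ * fine X](_ : _ = 1%E) ?mulr1//.
exact: probability_setT.
Qed.

Lemma average_payoff_le q1 T B : (0 < T)%N ->
  (forall w : seed pi, \sum_(1 <= t < T.+1) cond_payoff M w q1 t <= B) ->
  average_payoff M pi q1 T <= B / T%:R.
Proof.
move=> T0 H; rewrite /average_payoff sum_mean_payoff mulrC ler_wpM2r ?invr_ge0//.
rewrite -[leRHS]Rintegral_cst_seed; apply: le_Rintegral => //.
- exact: integrable_sum_cond_payoff.
- exact: integrable_cst_seed.
Qed.

Lemma average_payoff_ge q1 T B : (0 < T)%N ->
  (forall w : seed pi, B <= \sum_(1 <= t < T.+1) cond_payoff M w q1 t) ->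
  B / T%:R <= average_payoff M pi q1 T.
Proof.
move=> T0 H; rewrite /average_payoff sum_mean_payoff mulrC ler_wpM2l ?invr_ge0//.
rewrite -[leLHS]Rintegral_cst_seed; apply: le_Rintegral => //.
- exact: integrable_cst_seed.
- exact: integrable_sum_cond_payoff.
Qed.

Lemma average_payoff_bound q1 T : -1 <= average_payoff M pi q1 T <= 1.
Proof.
(* For [T = 0] the average is 0, the inverse of 0 being 0; the limits need a bound at every
   index. *)
have [->|T0] := posnP T; first by rewrite /average_payoff invr0 mul0r; lra.
have TR : T%:R != 0 :> R by rewrite pnatr_eq0 -lt0n.
have sumc (c : R) : \sum_(1 <= t < T.+1) c = T%:R * c.
  by rewrite sumr_const_nat subn1 mulr_natl.
apply/andP; split.
  rewrite -[leLHS](mulKf TR) mulrC; apply: average_payoff_ge => // w.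
  by rewrite -sumc; apply: ler_sum => t _; have /andP[] := cond_payoff_bound w q1 t.
rewrite -[leRHS](mulKf TR) mulrC; apply: average_payoff_le => // w.
by rewrite -sumc; apply: ler_sum => t _; have /andP[] := cond_payoff_bound w q1 t.
Qed.

End Averages.

(** * Upper and lower limits of bounded sequences with an error of order 1 / n *)

Section LimnSup.
Context {R : realType}.

Lemma limn_sup_le (u : nat -> R) (l c B : R) : 0 <= c ->
  (forall n, `|u n| <= B) -> (forall n, (0 < n)%N -> u n <= l + c / n%:R) ->
  limn_sup (u : R^o^nat) <= l.
Proof.
move=> c0 uB ul.
have ubu : has_ubound (range u).
  by exists B => _ [n _ <-]; exact: le_trans (ler_norm _) (uB n).
have lbu : has_lbound (range u).
  by exists (- B) => _ [n _ <-]; have := uB n; rewrite ler_norml => /andP[].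
apply/ler_addgt0Pr => e e0; apply: limr_le.
  by apply/cvg_ex; eexists; exact: cvg_sups_inf ubu lbu.
(* Taking [n >= 1] and [n >= c / e] makes the error at most [e] on the whole tail. *)
near=> n; apply: ge_sup; first by exists (u n) => /=; exists n => /=.
move=> _ /= [k nk <-].
have n0 : (0 < n)%N by near: n; exists 1%N.
have k0 : (0 < k)%N := leq_trans n0 nk.
apply: le_trans (ul k k0) _; rewrite lerD2l ler_pdivrMr ?ltr0n//.
rewrite mulrC -ler_pdivrMr//; apply: (@le_trans _ _ n%:R); last by rewrite ler_nat.
by near: n; exact: nbhs_infty_ger.
Unshelve. all: by end_near. Qed.

Lemma limn_inf_ge (u : nat -> R) (l c B : R) : 0 <= c ->
  (forall n, `|u n| <= B) -> (forall n, (0 < n)%N -> l - c / n%:R <= u n) ->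
  l <= limn_inf (u : R^o^nat).
Proof.
move=> c0 uB ul.
have ubu : has_ubound (range u).
  by exists B => _ [n _ <-]; exact: le_trans (ler_norm _) (uB n).
have lbu : has_lbound (range u).
  by exists (- B) => _ [n _ <-]; have := uB n; rewrite ler_norml => /andP[].
apply/ler_addgt0Pr => e e0; rewrite -lerBlDr; apply: limr_ge.
  by apply/cvg_ex; eexists; exact: cvg_infs_sup ubu lbu.
near=> n; apply: lb_le_inf; first by exists (u n) => /=; exists n => /=.
move=> _ /= [k nk <-].
have n0 : (0 < n)%N by near: n; exists 1%N.
have k0 : (0 < k)%N := leq_trans n0 nk.
apply: le_trans (ul k k0); rewrite lerD2l lerN2 ler_pdivrMr ?ltr0n//.
rewrite mulrC -ler_pdivrMr//; apply: (@le_trans _ _ n%:R); last by rewrite ler_nat.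
by near: n; exact: nbhs_infty_ger.
Unshelve. all: by end_near. Qed.

End LimnSup.

(** * Comparison of the optimum and of MBP with a common dual value *)

Section Regret.
Context {R : realType} {V Tau : finType} (M : market R V Tau).
Hypotheses (Mok : market_ok M) (Mreg : regular M) (conn : 0 < connectedness M)
  (V_gt1 : (1 < #|V|)%N).

Let m : R := #|V|%:R.

(** The benchmark for both sides. The spread is limited to 2 m so that the boundary term of weak
    duality is of order m K / T. *)
Definition min_dual : R :=
  inf [set dual M z | z in [set z : V -> R | forall a b, z a - z b <= 2 * m]].

Lemma min_dual_le (z : V -> R) : (forall a b, z a - z b <= 2 * m) -> min_dual <= dual M z.
Proof.
move=> zm; apply: ge_inf; last by exists z.
exists 0 => _ [y _ <-]; apply: sumr_ge0 => tau _.
by rewrite mulr_ge0 ?(phi_ge0 Mok) ?dual_type_ge0.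
Qed.

Lemma min_dual_ge c :
  (forall z : V -> R, (forall a b, z a - z b <= 2 * m) -> c <= dual M z) -> c <= min_dual.
Proof.
move=> H; apply: lb_le_inf; last by move=> _ [y ym <-]; exact: H.
by exists (dual M (fun=> 0)), (fun=> 0) => //= a b; rewrite subrr mulr_ge0.
Qed.

Lemma Omega_neq0 K : (Omega_ K : set (state (V := V))) !=set0.
Proof.
have /card_gt0P[i0 _] : (0 < #|V|)%N by exact: ltnW.
exists [ffun i => if i == i0 then K else 0%N]; rewrite /Omega_ /=.
rewrite (bigD1 i0)//= ffunE eqxx big1 ?addn0// => i /negPf i0i.
by rewrite ffunE i0i.
Qed.

Lemma average_payoff_le_min_dual pi K T q : feasible M pi -> (0 < T)%N ->
  Omega_ K q -> average_payoff M pi q T <= min_dual + 2 * m * K%:R / T%:R.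
Proof.
move=> feas T0 qK; rewrite -lerBlDr; apply: min_dual_ge => z zm; rewrite lerBlDr.
have /card_gt0P[i0 _] : (0 < #|V|)%N by exact: ltnW.
have TR : T%:R != 0 :> R by rewrite pnatr_eq0 -lt0n.
rewrite -[X in X + _](mulKf TR) (mulrC T%:R^-1) -mulrDl.
by apply: average_payoff_le => // w; exact: cond_payoff_le_dual.
Qed.

(** The existence of a feasible policy makes the set under the supremum nonempty. *)
Lemma optimal_payoff_le K T : (0 < T)%N -> (exists pi, feasible M pi) ->
  optimal_payoff M K T <= min_dual + 2 * m * K%:R / T%:R.
Proof.
move=> T0 [pi feas]; apply: ge_sup.
  by eexists; exists pi.
move=> _ [pi' feas' ->]; apply: ge_sup.
  by have [q qK] := Omega_neq0 K; exists (average_payoff M pi' q T), q.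
by move=> _ [q qK <-]; exact: average_payoff_le_min_dual.
Qed.

Lemma sup_average_payoff_bound pi K T : feasible M pi ->
  -1 <= sup [set average_payoff M pi q T | q in Omega_ K] <= 1.
Proof.
move=> feas; have [q qK] := Omega_neq0 K; apply/andP; split; last first.
  apply: ge_sup; first by exists (average_payoff M pi q T), q.
  by move=> _ [q' _ <-]; have /andP[] := average_payoff_bound Mok feas q' T.
apply: le_trans (_ : average_payoff M pi q T <= _).
  by have /andP[] := average_payoff_bound Mok feas q T.
apply: ub_le_sup; last by exists q.
by exists 1 => _ [q' _ <-]; have /andP[] := average_payoff_bound Mok feas q' T.
Qed.

Lemma optimal_payoff_bound pi K T : feasible M pi -> `|optimal_payoff M K T| <= 1.
Proof.
move=> feas; rewrite ler_norml; apply/andP; split; last first.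
  apply: ge_sup; first by eexists; exists pi.
  by move=> _ [pi' feas' ->]; have /andP[] := sup_average_payoff_bound K T feas'.
have /andP[h _] := sup_average_payoff_bound K T feas; apply: (le_trans h).
apply: ub_le_sup; last by exists pi.
exists 1 => _ [pi' feas' ->].
by have /andP[] := sup_average_payoff_bound K T feas'.
Qed.

Lemma worst_payoff_bound pi K T : feasible M pi -> `|worst_payoff M K T pi| <= 1.
Proof.
move=> feas; rewrite ler_norml; have [q qK] := Omega_neq0 K; apply/andP; split.
  apply: lb_le_inf; first by exists (average_payoff M pi q T), q.
  by move=> _ [q' _ <-]; have /andP[] := average_payoff_bound Mok feas q' T.
apply: le_trans (_ : average_payoff M pi q T <= _).
  apply: ge_inf; last by exists q.
  by exists (-1) => _ [q' _ <-]; have /andP[] := average_payoff_bound Mok feas q' T.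
by have /andP[] := average_payoff_bound Mok feas q T.
Qed.

Lemma worst_payoff_MBP_ge pi K T : feasible M pi ->
  is_MBP M (congestion V) K pi ->
  16 * m + 1 + 16 / connectedness M + 64 / connectedness M ^+ 2 <= Num.sqrt K%:R ->
  (0 < T)%N ->
  min_dual - 128 * m ^+ 2 / K%:R - 4 * m * K%:R / T%:R <= worst_payoff M K T pi.
Proof.
move=> feas mbp s_large T0.
have K0 := large_gt0 conn V_gt1 s_large.
have m1 : 1 < m by rewrite ltr1n.
(* Thus [K + m * Num.sqrt K] is at most [2 * K], and the range [2 * m] times this quantity of the
   potential is at most [4 * m * K]. *)
have ms : m * Num.sqrt K%:R <= K%:R.
  rewrite -[leRHS](sqr_sqrtr (ler0n R K)) expr2 ler_wpM2r ?sqrtr_ge0//.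
  have : 0 < 16 / connectedness M by rewrite divr_gt0.
  have : 0 < 64 / connectedness M ^+ 2 by rewrite divr_gt0// exprn_gt0.
  by move: s_large; lra.
apply: lb_le_inf.
  by have [q qK] := Omega_neq0 K; exists (average_payoff M pi q T), q.
move=> _ [q qK <-].
have TR : T%:R != 0 :> R by rewrite pnatr_eq0 -lt0n.
rewrite -[X in X - _](mulKf TR) (mulrC T%:R^-1) -mulrBl.
apply: average_payoff_ge => // w.
apply: (cond_payoff_sum_ge Mok T (Phi := potential K)) => obs.
  by apply: MBP_drift => // z; exact: min_dual_le.
have := potential_ge (R := R) K0 (state_after_Omega w feas obs qK).
have := @potential_le0 R _ _ K0 q; rewrite -[#|V|%:R]/m.
have : m * (m * Num.sqrt K%:R) <= m * K%:R by rewrite ler_wpM2l//; lra.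
lra.
Qed.

End Regret.

Theorem theorem3 (R : realType) :
  exists C : R, 0 < C /\
  forall (V Tau : finType) (M : market R V Tau),
    (1 < #|V|)%N ->
    market_ok M ->
    0 < connectedness M ->
    regular M ->
    exists (K1 : nat) (M1 M2 : R),
      [/\ M1 = C * #|V|%:R, M2 = C * #|V|%:R ^+ 2 &
        forall K : nat, (K1 <= K)%N ->
        forall pi : policy R V Tau,
          feasible M pi -> is_MBP M (congestion V) K pi ->
          (forall T : nat, (0 < T)%N ->
             loss M K T pi <= M1 * (K%:R / T%:R) + M2 * K%:R^-1) /\
          longrun_loss M K pi <= M2 * K%:R^-1].
Proof.
(* 128 is the constant of the balanced second-order term; it also exceeds the 2 + 4 coming from the
   two boundary terms. *)
exists 128; split=> // V Tau M V1 Mok conn Mreg.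
set m : R := #|V|%:R.
(* The sum of all thresholds that [Num.sqrt K] has to reach; [K1] bounds its square. *)
pose L : R := 16 * m + 1 + 16 / connectedness M + 64 / connectedness M ^+ 2.
have L0 : 0 <= L.
  by have c0 := ltW conn; rewrite /L !addr_ge0 ?mulr_ge0 ?invr_ge0 ?exprn_ge0.
exists (Num.bound (L ^+ 2)), (128 * m), (128 * m ^+ 2); split=> // K K1K pi feas mbp.
have LK : L <= Num.sqrt K%:R.
  rewrite -[leLHS](ger0_norm L0) -sqrtr_sqr ler_sqrt ?ler0n//.
  apply: le_trans (ltW (archi_boundP (sqr_ge0 L))) _.
  by rewrite ler_nat.
have up T (T0 : (0 < T)%N) := optimal_payoff_le Mok Mreg V1 K T0 (ex_intro _ pi feas).
have dn T := worst_payoff_MBP_ge Mok Mreg conn V1 feas mbp LK (T := T).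
have mK T : 0 <= m * K%:R / T%:R by rewrite !mulr_ge0 ?invr_ge0.
split=> [T T0|].
  have := up T T0; have := dn T T0; have := mK T; rewrite /loss -/m.
  lra.
rewrite /longrun_loss lerBlDr.
(* [min_dual M] separates the two limits: the optimum exceeds it by O(1 / T), and MBP falls short of
   it by 128 m^2 / K plus O(1 / T). *)
apply: (@le_trans _ _ (min_dual M)).
  apply: (@limn_sup_le _ _ _ (2 * m * K%:R) 1); first by rewrite !mulr_ge0.
    by move=> T; apply: optimal_payoff_bound feas.
  by move=> T T0; exact: up.
rewrite -lerBlDl.
apply: (@limn_inf_ge _ _ _ (4 * m * K%:R) 1); first by rewrite !mulr_ge0.
  by move=> T; apply: worst_payoff_bound.
by move=> T T0; exact: dn.
Qed.
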